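(* Let $S$ be a Hermitian positive definite $n \times n$ matrix partitioned as $$S = \begin{bmatrix} A & B \\ B^* & C \end{bmatrix}$$ where $A$ is $n_A \times n_A$ with $1 \leq n_A < n$. Let $Z_A$ be an $n_A\times n_A$ matrix and $Z_C$ an $(n-n_A)\times(n-n_A)$ matrix with $Z_A^* A Z_A = I$ and $Z_C^* C Z_C = I$, and let $$Z_0 = \begin{bmatrix} Z_A & 0 \\ 0 & Z_C \end{bmatrix}.$$ Then $$\lambda_{\mathrm{min}}(S) \leq \lambda_i(A) \leq \lambda_{\mathrm{max}}(S), \quad i = 1, \dots, n_A,$$ $$\lambda_{\mathrm{min}}(S) \leq \lambda_i(C) \leq \lambda_{\mathrm{max}}(S), \quad i = 1, \dots, n-n_A,$$ $$\frac{\lambda_{\mathrm{min}}(S)}{\lambda_{\mathrm{max}}(S)}-1 \leq \lambda_i(I-Z_0^*SZ_0) \leq 1-\frac{\lambda_{\mathrm{min}}(S)}{\lambda_{\mathrm{max}}(S)}, \quad i = 1, \dots, n.$$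
   Context: Matrices are complex and $^*$ denotes the conjugate transpose. For a Hermitian matrix $H$, $\lambda_i(H)$ denotes its $i$th eigenvalue, and $\lambda_{\mathrm{min}}(H)$, $\lambda_{\mathrm{max}}(H)$ its smallest and largest eigenvalues. *)

(* Defs.v *)
From HB Require Import structures.
From mathcomp Require Export all_boot all_order all_algebra.
From mathcomp Require Export complex.
From mathcomp Require Export reals.

Set Implicit Arguments.
Unset Strict Implicit.
Unset Printing Implicit Defensive.

Import Order.TTheory GRing.Theory Num.Theory.
Local Open Scope ring_scope.
Local Open Scope sesquilinear_scope.

Definition posdefmx (F : numClosedFieldType) n (H : 'M[F]_n) : Prop :=
  H \is hermsymmx /\
  forall x : 'cV[F]_n, x != 0 -> 0 < (x ^t* *m H *m x) 0 0.

(* The roots of the characteristic polynomial with multiplicity.  The order of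
   F is only partial, but it is total on the real elements, hence on the
   eigenvalues of a Hermitian matrix, which are thus listed nondecreasingly. *)
Definition eigenvalues (F : numClosedFieldType) n (H : 'M[F]_n) : seq F :=
  sort <=%R (sval (closed_field_poly_normal (char_poly H))).

Lemma char_poly_eigenvalues (F : numClosedFieldType) n (H : 'M[F]_n) :
  char_poly H = \prod_(z <- eigenvalues H) ('X - z%:P).
Proof.
rewrite /eigenvalues; case: closed_field_poly_normal => r /= Hr.
rewrite {1}Hr (monicP (char_poly_monic H)) scale1r.
by apply: perm_big; rewrite perm_sym perm_sort.
Qed.

Lemma size_eigenvalues (F : numClosedFieldType) n (H : 'M[F]_n) :
  size (eigenvalues H) = n.
Proof.
have := size_char_poly H.
by rewrite char_poly_eigenvalues size_prod_XsubC => -[].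
Qed.

(* Indices start at 0. *)
Definition lambda (F : numClosedFieldType) n (H : 'M[F]_n) (i : 'I_n) : F :=
  (eigenvalues H)`_i.

(* First and last entries of the sorted list; meaningful when 0 < n. *)
Definition lambda_min (F : numClosedFieldType) n (H : 'M[F]_n) : F :=
  head 0 (eigenvalues H).

Definition lambda_max (F : numClosedFieldType) n (H : 'M[F]_n) : F :=
  last 0 (eigenvalues H).

(* Main.v *)
(* All three bounds compare Rayleigh quotients.  Vectors supported on one block
   give the bounds for A and C.  For M = Z0^* S Z0 and y = Z0 x, the
   normalization Z0^* diag(A, C) Z0 = I and the bounds for A and C give
   |x|^2 <= lambda_max(S) |y|^2, so x^* M x = y^* S y is at least
   (lambda_min(S) / lambda_max(S)) |x|^2.  As M has identity diagonal blocks,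
   flipping the sign of the second block of x replaces x^* M x by
   2 |x|^2 - x^* M x, and the lower bound becomes an upper bound.  Vectors are
   rows below, as in MathComp's [eigenvalue]. *)
Require Import Defs.

Set Implicit Arguments.
Unset Strict Implicit.
Unset Printing Implicit Defensive.

Import Order.TTheory GRing.Theory Num.Theory.

Section QuadraticForm.
Local Open Scope ring_scope.
Local Open Scope sesquilinear_scope.

Variable F : numClosedFieldType.

(** * Quadratic forms and squared norms of row vectors *)

Lemma trmxC_mul m n p (M : 'M[F]_(m, n)) (N : 'M[F]_(n, p)) :
  (M *m N) ^t* = N ^t* *m M ^t*.
Proof. by rewrite trmx_mul map_mxM. Qed.

Lemma hermsymmx_trmxC n (H : 'M[F]_n) : H \is hermsymmx -> H ^t* = H.
Proof.
by move=> /is_hermitianmxP; rewrite expr0 scale1r => <-.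
Qed.

Definition quadf n (H : 'M[F]_n) (x : 'rV[F]_n) : F := (x *m H *m x ^t*) 0 0.

Definition sqnorm n (x : 'rV[F]_n) : F := (x *m x ^t*) 0 0.

Lemma sqnormE n (x : 'rV[F]_n) : sqnorm x = \sum_j `|x 0 j| ^+ 2.
Proof. by rewrite /sqnorm !mxE; apply: eq_bigr => j _; rewrite !mxE normCK. Qed.

Lemma sqnorm_ge0 n (x : 'rV[F]_n) : 0 <= sqnorm x.
Proof. by rewrite sqnormE sumr_ge0 // => j _; rewrite exprn_ge0. Qed.

Lemma sqnorm_gt0 n (x : 'rV[F]_n) : (0 < sqnorm x) = (x != 0).
Proof.
rewrite lt0r sqnorm_ge0 andbT sqnormE; congr (~~ _).
rewrite psumr_eq0 => [|j _]; last by rewrite exprn_ge0.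
apply/allP/eqP => [x0|-> j _]; last by rewrite mxE normr0 expr0n eqxx.
apply/rowP => j; apply/eqP; have := x0 j (mem_index_enum j).
by rewrite /= expf_eq0 /= normr_eq0 mxE.
Qed.

Lemma quadf_diag n (d x : 'rV[F]_n) :
  quadf (diag_mx d) x = \sum_j d 0 j * `|x 0 j| ^+ 2.
Proof.
rewrite /quadf mul_mx_diag !mxE; apply: eq_bigr => j _.
by rewrite !mxE normCK [x 0 j * d 0 j]mulrC mulrA.
Qed.

Lemma quadf_mul m n (H : 'M[F]_n) (Z : 'M[F]_(n, m)) (x : 'rV[F]_m) :
  quadf (Z ^t* *m H *m Z) x = quadf H (x *m Z ^t*).
Proof. by rewrite /quadf trmxC_mul trmxCK !mulmxA. Qed.

Lemma quadf1 n (x : 'rV[F]_n) : quadf 1%:M x = sqnorm x.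
Proof. by rewrite /quadf mulmx1. Qed.

Lemma quadf_1subr n (H : 'M[F]_n) (x : 'rV[F]_n) :
  quadf (1%:M - H) x = sqnorm x - quadf H x.
Proof. by rewrite /quadf mulmxBr mulmx1 mulmxBl mxE [X in _ + X]mxE. Qed.

Lemma quadf_real n (H : 'M[F]_n) (x : 'rV[F]_n) :
  H \is hermsymmx -> quadf H x \is Num.real.
Proof.
move=> Hherm; apply/CrealP.
have -> : (quadf H x)^* = ((x *m H *m x ^t*) ^t*) 0 0.
  by rewrite [RHS]mxE [in RHS]mxE.
by rewrite !trmxC_mul trmxCK hermsymmx_trmxC // mulmxA.
Qed.

Lemma quadf_row_mx m n (A : 'M[F]_m) (B : 'M[F]_(m, n)) (B' : 'M[F]_(n, m))
    (C : 'M[F]_n) (u : 'rV[F]_m) (v : 'rV[F]_n) :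
  quadf (block_mx A B B' C) (row_mx u v) =
  quadf A u + quadf C v + (v *m B' *m u ^t* + u *m B *m v ^t*) 0 0.
Proof.
rewrite /quadf tr_row_mx map_col_mx mul_row_block mul_row_col !mulmxDl.
have mx11D (M N : 'M[F]_1) : (M + N) 0 0 = M 0 0 + N 0 0 by rewrite mxE.
by rewrite !mx11D [X in _ + X]addrC addrACA.
Qed.

Lemma sqnorm_row_mx m n (u : 'rV[F]_m) (v : 'rV[F]_n) :
  sqnorm (row_mx u v) = sqnorm u + sqnorm v.
Proof. by rewrite /sqnorm tr_row_mx map_col_mx mul_row_col mxE. Qed.

Lemma sqnormN n (x : 'rV[F]_n) : sqnorm (- x) = sqnorm x.
Proof. by rewrite !sqnormE; apply: eq_bigr => j _; rewrite mxE normrN. Qed.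

(** * Eigenvalues as values of the quadratic form *)

Lemma mem_eigenvalues n (H : 'M[F]_n) z : (z \in eigenvalues H) = eigenvalue H z.
Proof. by rewrite eigenvalue_root_char char_poly_eigenvalues root_prod_XsubC. Qed.

Lemma eigenvalues_quadf n (H : 'M[F]_n) z : z \in eigenvalues H ->
  exists2 x, x != 0 & quadf H x = z * sqnorm x.
Proof.
rewrite mem_eigenvalues => /eigenvalueP[x xH x0]; exists x => //.
by rewrite /quadf xH -scalemxAl mxE.
Qed.

Lemma lambda_mem n (H : 'M[F]_n) (k : 'I_n) : lambda H k \in eigenvalues H.
Proof. by rewrite mem_nth // size_eigenvalues. Qed.

(** Evaluate the hypothesis at an eigenvector and cancel its positive squared norm. *)
Lemma lambda_bounds n (H : 'M[F]_n) (a b : F) :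
  (forall x, a * sqnorm x <= quadf H x <= b * sqnorm x) ->
  forall k, a <= lambda H k <= b.
Proof.
move=> Hab k; have [x x0 xE] := eigenvalues_quadf (lambda_mem H k).
by have := Hab x; rewrite xE !ler_pM2r // sqnorm_gt0.
Qed.

Lemma eigenvalues_real n (H : 'M[F]_n) z :
  H \is hermsymmx -> z \in eigenvalues H -> z \is Num.real.
Proof.
move=> Hherm /eigenvalues_quadf[x x0 xE].
have q0 : sqnorm x != 0 by rewrite lt0r_neq0 // sqnorm_gt0.
rewrite -(mulfK q0 z) -xE rpred_div ?quadf_real //.
by rewrite ger0_real // sqnorm_ge0.
Qed.

Lemma eigenvalues_sorted n (H : 'M[F]_n) :
  H \is hermsymmx -> sorted <=%R (eigenvalues H).
Proof.
move=> Hherm; apply: (sort_sorted_in (P := Num.real)).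
  by move=> x y xR yR; exact: real_leVge.
apply/allP => z zH; apply: (eigenvalues_real Hherm).
by rewrite /eigenvalues mem_sort.
Qed.

Lemma lambda_minmax n (H : 'M[F]_n) z : H \is hermsymmx ->
  z \in eigenvalues H -> lambda_min H <= z <= lambda_max H.
Proof.
move=> /eigenvalues_sorted; rewrite /lambda_min /lambda_max.
rewrite -nth0 -nth_last => sH zs.
have iH : (index z (eigenvalues H) < size (eigenvalues H))%N by rewrite index_mem.
(* The membership of [z] makes the list nonempty, so its last index really is the predecessor of its
   size. *)
have H0 : (0 < size (eigenvalues H))%N := leq_ltn_trans (leq0n _) iH.
have le_nth := sorted_leq_nth le_trans lexx 0 sH.
rewrite -(nth_index 0 zs) !le_nth ?inE ?prednK //.
by rewrite -ltnS prednK.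
Qed.

(** From [H = P^-1 D P] follows [P H = D P], so row [j] of [P] is an eigenvector for the [j]th
    diagonal entry. *)
Lemma spectral_diag_eigenvalues n (H : 'M[F]_n) (j : 'I_n) :
  H \is hermsymmx -> spectral_diag H 0 j \in eigenvalues H.
Proof.
move=> /hermitian_normalmx/orthomx_spectralP HE.
set P := spectralmx H in HE; have Pu : P \in unitmx := spectral_unit H.
have PH : P *m H = diag_mx (spectral_diag H) *m P.
  by rewrite [X in P *m X]HE !mulmxA mulmxV // mul1mx.
rewrite mem_eigenvalues; apply/eigenvalueP; exists (row j P).
  by rewrite -row_mul PH row_mul row_diag_mx -scalemxAl -rowE.
(* A zero row would contradict the invertibility of [P]. *)
by apply: contraTneq Pu => Pj0; rewrite -row_free_unit; apply/row_freePn;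
   exists j; rewrite Pj0 sub0mx.
Qed.

(** In the unitary coordinates [y] the norm is unchanged and the form is a sum of [|y_j|^2] weighted
    by eigenvalues, each between the extreme ones. *)
Lemma rayleigh_bounds n (H : 'M[F]_n) (x : 'rV[F]_n) : H \is hermsymmx ->
  lambda_min H * sqnorm x <= quadf H x <= lambda_max H * sqnorm x.
Proof.
move=> Hherm.
have /orthomx_spectralP HE := hermitian_normalmx Hherm.
have Pu := spectral_unitarymx H; rewrite invmx_unitary // in HE.
pose y := x *m (spectralmx H) ^t*.
have -> : sqnorm x = sqnorm y.
  by rewrite /sqnorm /y trmxC_mul trmxCK mulmxA mulmxKtV.
(* The right side of [HE] mentions [H] again, and so do the bounds; [congr1] confines the rewriting
   to the form. *)
rewrite [quadf H x](congr1 (@quadf n ^~ x) HE) quadf_mul -/y quadf_diag.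
rewrite sqnormE !mulr_sumr; apply/andP; split; apply: ler_sum => j _;
  by rewrite ler_wpM2r ?exprn_ge0 //;
     case/andP: (lambda_minmax Hherm (spectral_diag_eigenvalues j Hherm)).
Qed.

(** Passes from the columns of [posdefmx] to rows, by testing on [x ^t*]. *)
Lemma posdefmx_quadf n (H : 'M[F]_n) (x : 'rV[F]_n) :
  posdefmx H -> x != 0 -> 0 < quadf H x.
Proof.
move=> [_ Hpos] x0; have := Hpos (x ^t*); rewrite trmxCK; apply.
by apply: contraNneq x0 => xt0; rewrite -[x]trmxCK xt0 trmx0 map_mx0.
Qed.

Lemma posdefmx_eigenvalues n (H : 'M[F]_n) z :
  posdefmx H -> z \in eigenvalues H -> 0 < z.
Proof.
move=> Hpos /eigenvalues_quadf[x x0 xE].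
by have := posdefmx_quadf Hpos x0; rewrite xE pmulr_lgt0 // sqnorm_gt0.
Qed.

(** At [n = 0] the value would be the default 0 of [head], hence the condition on [n]. *)
Lemma lambda_min_gt0 n (H : 'M[F]_n) :
  (0 < n)%N -> posdefmx H -> 0 < lambda_min H.
Proof.
move=> n0 Hpos; apply: (posdefmx_eigenvalues Hpos).
rewrite /lambda_min -nth0; apply: mem_nth; by rewrite size_eigenvalues.
Qed.

Lemma lambda_max_gt0 n (H : 'M[F]_n) :
  (0 < n)%N -> posdefmx H -> 0 < lambda_max H.
Proof.
move=> n0 Hpos; apply: (posdefmx_eigenvalues Hpos).
rewrite /lambda_max -nth_last; apply: mem_nth.
by rewrite size_eigenvalues prednK.
Qed.

(** * Two-by-two block matrices and their block-diagonal normalization *)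

Section Block.

Variables (m n : nat) (A : 'M[F]_m) (B : 'M[F]_(m, n)) (B' : 'M[F]_(n, m)).
Variable C : 'M[F]_n.

Lemma quadf_block_l (u : 'rV[F]_m) :
  quadf (block_mx A B B' C) (row_mx u 0) = quadf A u.
Proof.
rewrite quadf_row_mx /quadf !mul0mx trmx0 map_mx0 mulmx0.
by rewrite addr0 !mxE !addr0.
Qed.

Lemma quadf_block_r (v : 'rV[F]_n) :
  quadf (block_mx A B B' C) (row_mx 0 v) = quadf C v.
Proof.
rewrite quadf_row_mx /quadf !mul0mx trmx0 map_mx0 mulmx0.
by rewrite addr0 !mxE addr0 add0r.
Qed.

Lemma sqnorm0 k : sqnorm (0 : 'rV[F]_k) = 0.
Proof. by rewrite /sqnorm mul0mx mxE. Qed.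

Let S := block_mx A B B' C.
Hypothesis Sherm : S \is hermsymmx.

Lemma rayleigh_bounds_ul (u : 'rV[F]_m) :
  lambda_min S * sqnorm u <= quadf A u <= lambda_max S * sqnorm u.
Proof.
have := rayleigh_bounds (row_mx u 0) Sherm.
by rewrite quadf_block_l sqnorm_row_mx sqnorm0 addr0.
Qed.

Lemma rayleigh_bounds_dr (v : 'rV[F]_n) :
  lambda_min S * sqnorm v <= quadf C v <= lambda_max S * sqnorm v.
Proof.
have := rayleigh_bounds (row_mx 0 v) Sherm.
by rewrite quadf_block_r sqnorm_row_mx sqnorm0 add0r.
Qed.

Variables (ZA : 'M[F]_m) (ZC : 'M[F]_n).
Hypotheses (hZA : ZA ^t* *m A *m ZA = 1%:M) (hZC : ZC ^t* *m C *m ZC = 1%:M).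

Let Z0 := block_mx ZA 0 0 ZC.

Lemma mul_row_Z0 (u : 'rV[F]_m) (v : 'rV[F]_n) :
  row_mx u v *m Z0 ^t* = row_mx (u *m ZA ^t*) (v *m ZC ^t*).
Proof.
rewrite tr_block_mx map_block_mx !trmx0 !map_mx0 mul_row_block.
by rewrite !mulmx0 addr0 add0r.
Qed.

Lemma sqnorm_le_Z0 x : sqnorm x <= lambda_max S * sqnorm (x *m Z0 ^t*).
Proof.
rewrite -[x]hsubmxK mul_row_Z0 !sqnorm_row_mx mulrDr.
(* The normalization turns the norm of a block of [x] into a value of the form of [A] or [C], to
   which the upper Rayleigh bound applies. *)
have nZ k (H Z : 'M[F]_k) u : Z ^t* *m H *m Z = 1%:M ->
    sqnorm u = quadf H (u *m Z ^t*).
  by move=> HZ; rewrite -quadf_mul HZ quadf1.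
rewrite (nZ _ _ _ _ hZA) (nZ _ _ _ _ hZC) lerD //.
  by case/andP: (rayleigh_bounds_ul (lsubmx x *m ZA ^t*)).
by case/andP: (rayleigh_bounds_dr (rsubmx x *m ZC ^t*)).
Qed.

Lemma quadf_Z0_ge x : 0 <= lambda_min S -> 0 < lambda_max S ->
  lambda_min S / lambda_max S * sqnorm x <= quadf (Z0 ^t* *m S *m Z0) x.
Proof.
move=> m0 M0; rewrite quadf_mul.
case/andP: (rayleigh_bounds (x *m Z0 ^t*) Sherm) => le_y _.
(* Nonnegativity of [lambda_min S] allows multiplying the norm comparison by it. *)
apply: le_trans le_y; rewrite -mulrA ler_wpM2l // ler_pdivrMl //.
exact: sqnorm_le_Z0.
Qed.

(** The identity diagonal blocks contribute the squared norm whatever the sign of [v], while the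
    off-diagonal terms change sign; the two values thus add up to twice the squared norm. *)
Lemma quadf_Z0_reflect (u : 'rV[F]_m) (v : 'rV[F]_n) :
  quadf (Z0 ^t* *m S *m Z0) (row_mx u (- v)) =
  sqnorm (row_mx u v) *+ 2 - quadf (Z0 ^t* *m S *m Z0) (row_mx u v).
Proof.
have -> : Z0 ^t* *m S *m Z0 =
    block_mx 1%:M (ZA ^t* *m B *m ZC) (ZC ^t* *m B' *m ZA) 1%:M.
  rewrite tr_block_mx map_block_mx !trmx0 !map_mx0 !mulmx_block.
  by rewrite !(mulmx0, mul0mx, addr0, add0r) hZA hZC.
rewrite !quadf_row_mx !quadf1 sqnormN.
rewrite sqnorm_row_mx !mulNmx [(- v) ^T]linearN /= map_mxN mulmxN -opprD mxE.
by rewrite opprD addrA mulr2n addrK.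
Qed.

Lemma lambda_1sub_Z0_bounds : 0 <= lambda_min S -> 0 < lambda_max S ->
  forall k, lambda_min S / lambda_max S - 1
      <= lambda (1%:M - Z0 ^t* *m S *m Z0) k
      <= 1 - lambda_min S / lambda_max S.
Proof.
move=> m0 M0; apply: lambda_bounds => x.
(* The upper bound for the difference is the lower bound [quadf_Z0_ge] at [x] itself. *)
rewrite quadf_1subr !mulrBl mul1r lerD2l lerN2 quadf_Z0_ge // andbT.
(* The remaining lower bound is [quadf_Z0_ge] at the reflected vector, which has the same norm as
   [x]. *)
have := quadf_Z0_ge (row_mx (lsubmx x) (- rsubmx x)) m0 M0.
rewrite quadf_Z0_reflect sqnorm_row_mx sqnormN -sqnorm_row_mx hsubmxK.
by rewrite lerBlDr mulr2n addrAC.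
Qed.

End Block.

End QuadraticForm.

Local Open Scope ring_scope.
Local Open Scope sesquilinear_scope.
Local Open Scope complex_scope.

Theorem theorem4p1 (R : realType) (nA nC : nat)
    (hnA : (0 < nA)%N) (hnC : (0 < nC)%N)
    (S : 'M[R[i]]_(nA + nC))
    (A : 'M[R[i]]_nA) (B : 'M[R[i]]_(nA, nC)) (C : 'M[R[i]]_nC)
    (hS : posdefmx S)
    (hSblock : S = block_mx A B (B ^t*) C)
    (ZA : 'M[R[i]]_nA) (ZC : 'M[R[i]]_nC)
    (hZA : ZA ^t* *m A *m ZA = 1%:M)
    (hZC : ZC ^t* *m C *m ZC = 1%:M)
    (Z0 : 'M[R[i]]_(nA + nC))
    (hZ0 : Z0 = block_mx ZA 0 0 ZC) :
  [/\ forall k : 'I_nA, lambda_min S <= lambda A k <= lambda_max S,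
      forall k : 'I_nC, lambda_min S <= lambda C k <= lambda_max S &
      forall k : 'I_(nA + nC),
        lambda_min S / lambda_max S - 1
          <= lambda (1%:M - Z0 ^t* *m S *m Z0) k
          <= 1 - lambda_min S / lambda_max S].
Proof.
have n0 : (0 < nA + nC)%N by rewrite addn_gt0 hnA.
(* These signs are what the third bound takes from positive definiteness; beyond them, all three
   bounds rest on [S] being Hermitian. *)
have m0 := ltW (lambda_min_gt0 n0 hS); have M0 := lambda_max_gt0 n0 hS.
case: hS => Sherm _; subst S Z0; split.
- exact: lambda_bounds (rayleigh_bounds_ul Sherm).
- exact: lambda_bounds (rayleigh_bounds_dr Sherm).
- exact: lambda_1sub_Z0_bounds.
Qed.
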